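(* For every integer $r\ge 3$ there is a constant $c_r$ such that for every graph $G$ with $m$ edges and no isolated vertices, \[ r(K_r,G)\le c_r\, m^{\frac{r-1}{2}}. \]
   Context: For graphs $H$ and $G$, the Ramsey number $r(H,G)$ is the least positive integer $N$ such that every red/blue coloring of the edges of the complete graph $K_N$ contains a red copy of $H$ or a blue copy of $G$. $K_r$ denotes the complete graph on $r$ vertices. *)

(* Defs.v *)
From HB Require Import structures.
From mathcomp Require Import all_boot all_order all_algebra.
From mathcomp Require Import all_reals exp.

Set Implicit Arguments.
Unset Strict Implicit.
Unset Printing Implicit Defensive.

Record sgraph := SGraph {
  vertex :> finType;
  adj : rel vertex;
  adj_sym : symmetric adj;
  adj_irrefl : irreflexive adj
}.

Definition edges (G : sgraph) : {set {set G}} :=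
  [set E : {set G} | [exists x, exists y, adj x y && (E == [set x; y])]].

Definition no_isolated (G : sgraph) : Prop :=
  forall x : G, exists y : G, adj x y.

Lemma neq_sym (T : eqType) : symmetric (fun x y : T => x != y).
Proof. by move=> x y; rewrite eq_sym. Qed.

Lemma neq_irrefl (T : eqType) : irreflexive (fun x y : T => x != y).
Proof. by move=> x; rewrite eqxx. Qed.

Definition complete_graph (n : nat) : sgraph :=
  SGraph (@neq_sym 'I_n) (@neq_irrefl 'I_n).

(* An edge of K_N is a set [set i; j] with i != j; the values of a coloring on
   the other subsets of 'I_N are never used. Red is true, blue is false. *)
Definition coloring (N : nat) := {ffun {set 'I_N} -> bool}.

(* A copy is a not necessarily induced subgraph. *)
Definition mono_copy (N : nat) (c : coloring N) (b : bool) (G : sgraph) : bool :=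
  [exists f : {ffun G -> 'I_N},
    injectiveb f &&
    [forall x, forall y, adj x y ==> (c [set f x; f y] == b)]].

Definition arrows (N : nat) (H G : sgraph) : bool :=
  [forall c : coloring N, mono_copy c true H || mono_copy c false G].

Definition mono_clique (T : finType) (c : {set T} -> bool) (b : bool)
    (B : {set T}) : Prop :=
  forall x y, x \in B -> y \in B -> x != y -> c [set x; y] = b.

Lemma mono_clique_add (T : finType) (c : {set T} -> bool) (b : bool)
    (B : {set T}) (x : T) :
  mono_clique c b B -> (forall y, y \in B -> c [set x; y] = b) ->
  mono_clique c b (x |: B).
Proof.
move=> cB cx y z; rewrite !inE => /orP[/eqP->|yB] /orP[/eqP->|zB].
- by rewrite eqxx.
- by move=> _; apply: cx.
- by move=> _; rewrite setUC; apply: cx.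
- exact: cB.
Qed.

Lemma ramsey_cliques (s t : nat) : exists N, forall (T : finType)
    (c : {set T} -> bool) (A : {set T}), N <= #|A| ->
  exists2 B : {set T}, B \subset A &
    (#|B| = s /\ mono_clique c true B) \/ (#|B| = t /\ mono_clique c false B).
Proof.
elim: s t => [|s IHs] t.
  exists 0 => T c A _; exists set0; first exact: sub0set.
  by left; rewrite cards0; split=> // x y; rewrite inE.
elim: t => [|t [N2 IHt]].
  exists 0 => T c A _; exists set0; first exact: sub0set.
  by right; rewrite cards0; split=> // x y; rewrite inE.
have [N1 {}IHs] := IHs t.+1; exists (N1 + N2).+1 => T c A leA.
have /card_gt0P[x xA] : 0 < #|A| by apply: leq_ltn_trans leA.
pose P := [set y | c [set x; y]].
have subA (D : {set T}) : D \subset A :\ x -> x |: D \subset A.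
  by move=> sD; rewrite subUset sub1set xA (subset_trans sD) ?subsetDl.
have cardU (D : {set T}) : D \subset A :\ x -> #|x |: D| = #|D|.+1.
  move=> sD; rewrite cardsU1; case: (boolP (x \in D)) => //= /(subsetP sD).
  by rewrite !inE eqxx.
have : N1 + N2 <= #|(A :\ x) :&: P| + #|(A :\ x) :\: P|.
  by rewrite cardsID -ltnS (leq_trans leA) // (cardsD1 x A) xA.
case: (leqP N1 #|(A :\ x) :&: P|) => [le1 _|lt1 leN].
  have [B sB HB] := IHs T c _ le1.
  have sBx : B \subset A :\ x by apply: subset_trans sB (subsetIl _ _).
  case: HB => [[cB mB]|[cB mB]].
    exists (x |: B); first exact: subA.
    left; split; first by rewrite cardU // cB.
    apply: mono_clique_add => // y /(subsetP sB).
    by rewrite !inE => /andP[_ ->].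
  exists B; first exact: subset_trans sBx (subsetDl _ _).
  by right.
have le2 : N2 <= #|(A :\ x) :\: P|.
  by rewrite -(leq_add2l N1) (leq_trans leN) // leq_add2r ltnW.
have [B sB HB] := IHt T c _ le2.
have sBx : B \subset A :\ x by apply: subset_trans sB (subsetDl _ _).
case: HB => [[cB mB]|[cB mB]].
  exists B; first exact: subset_trans sBx (subsetDl _ _).
  by left.
exists (x |: B); first exact: subA.
right; split; first by rewrite cardU // cB.
apply: mono_clique_add => // y /(subsetP sB).
by rewrite !inE => /andP[/negbTE-> _].
Qed.

Lemma mono_clique_copy (N : nat) (c : coloring N) (b : bool) (G : sgraph)
    (B : {set 'I_N}) :
  #|B| = #|G| -> mono_clique c b B -> mono_copy c b G.
Proof.
move=> cB mB; apply/existsP.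
pose f (x : G) := enum_val (cast_ord (esym cB) (enum_rank x)).
have finj : injective f.
  by move=> x y /enum_val_inj/cast_ord_inj/enum_rank_inj.
exists (finfun f); apply/andP; split.
  by apply/injectiveP => x y; rewrite !ffunE => /finj.
apply/'forall_forallP => x y; apply/implyP => xy; rewrite !ffunE; apply/eqP.
apply: mB; try exact: enum_valP.
by apply: contraTneq xy => /finj->; rewrite adj_irrefl.
Qed.

Lemma ramsey_exists (H G : sgraph) : exists N, (0 < N) && arrows N H G.
Proof.
have [N HN] := ramsey_cliques #|H| #|G|; exists N.+1; apply/forallP => c.
have leN : N <= #|[set: 'I_N.+1]| by rewrite cardsT card_ord.
have [B _ [] [cB mB]] := HN _ c _ leN.
  by rewrite (mono_clique_copy cB mB).
by rewrite (mono_clique_copy cB mB) orbT.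
Qed.

Definition ramsey_number (H G : sgraph) : nat := ex_minn (ramsey_exists H G).

(* Main.v *)
Require Import Defs.
From HB Require Import structures.
From mathcomp Require Import all_boot all_order all_algebra.
From mathcomp Require Import all_reals exp.
From mathcomp Require Import zify.

Set Implicit Arguments.
Unset Strict Implicit.
Unset Printing Implicit Defensive.
Import Order.TTheory GRing.Theory Num.Theory.
Local Open Scope ring_scope.

(** Write D for the maximum red degree.  If there is no red triangle, a red
    neighbourhood of size D is a blue clique; it hosts all vertices of G of
    degree greater than 2m / D, since there are at most D of them.  Each of
    the other vertices can then be embedded greedily: its at most 2m / D
    neighbours exclude at most 2m host vertices, and the vertices already used
    exclude fewer than |V(G)| <= 2m others, so 4m host vertices suffice.  For
    larger r, either some red neighbourhood contains a blue copy of G by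
    induction, or all red degrees are at most the bound for r - 1.  In the
    latter case, G is embedded greedily, starting with the at most sqrt (2m)
    vertices of degree greater than sqrt (2m), so that at every step at most
    sqrt (2m) neighbours have been embedded. *)

(** * Degree counts and vertices of large degree *)

Section Degrees.
Local Open Scope nat_scope.
Variable G : sgraph.

Definition degree (x : G) := #|[set y | adj x y]|.

Lemma card_edge (E : {set G}) : E \in edges G -> #|E| = 2.
Proof.
rewrite inE => /existsP[x /existsP[y /andP[xy /eqP->]]].
by rewrite cards2; case: eqP xy => // ->; rewrite adj_irrefl.
Qed.

(** The map sending [y] to [[set x; y]] is a bijection from the neighbours of [x] onto the edges at
    [x]. *)
Lemma degreeE (x : G) : degree x = #|[set E in edges G | x \in E]|.
Proof.
rewrite /degree -(card_in_imset (f := fun y => [set x; y])); last first.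
  move=> y z; rewrite !inE => xy xz /setP /(_ y).
  rewrite !inE eqxx orbT => /esym/orP[/eqP yx|/eqP//].
  by rewrite yx adj_irrefl in xy.
apply: eq_card => E; rewrite !inE; apply/imsetP/andP => [[y]|].
  rewrite inE => xy ->; split; last by rewrite !inE eqxx.
  by apply/existsP; exists x; apply/existsP; exists y; rewrite xy eqxx.
case=> /existsP[a /existsP[b /andP[ab /eqP->]]]; rewrite !inE.
case/orP=> /eqP->; first by exists b; rewrite ?inE.
by exists a; rewrite ?inE 1?adj_sym // setUC.
Qed.

Lemma handshake : \sum_(x : G) degree x = 2 * #|edges G|.
Proof.
transitivity (\sum_(x : G) \sum_(E in edges G | x \in E) 1).
  apply: eq_bigr => x _; rewrite degreeE -sum1_card.
  by apply: eq_bigl => E; rewrite inE.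
rewrite (exchange_big_dep (mem (edges G))) /=; last by move=> x E _ /andP[].
rewrite mulnC -sum_nat_const.
apply: eq_bigr => E eE; rewrite -(card_edge eE) -sum1_card.
by apply: eq_bigl => x; rewrite eE.
Qed.

Lemma no_isolated_card : no_isolated G -> #|G| <= 2 * #|edges G|.
Proof.
move=> noiso; rewrite -handshake -sum1_card leq_sum // => x _.
by have [y xy] := noiso x; apply/card_gt0P; exists y; rewrite inE.
Qed.

(** The condition degree > 2m / t is written without division, so that [t = 0] gives the empty
    set. *)
Definition large_degree (t : nat) : {set G} :=
  [set x | 2 * #|edges G| < degree x * t].

(** More than [t] such vertices would have degree sum above 2m, against [handshake]. *)
Lemma card_large_degree t : #|large_degree t| <= t.
Proof.
set m2 := 2 * #|edges G|; rewrite leqNgt; apply/negP => tL.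
have : \sum_(x in large_degree t) m2.+1 <= \sum_(x in large_degree t) degree x * t.
  by apply: leq_sum => x; rewrite inE.
rewrite sum_nat_const -big_distrl /=.
have : \sum_(x in large_degree t) degree x <= m2.
  by rewrite /m2 -handshake [leqRHS](bigID (mem (large_degree t))) leq_addr.
nia.
Qed.

End Degrees.

(** * Blue embeddings and their greedy extension *)

Section Embedding.
Local Open Scope nat_scope.
Variables (T : finType) (c : {set T} -> bool).

(** The test [y != x] discards the singleton [[set x; x]], whose color is meaningless. *)
Definition red_nbhd (S : {set T}) (x : T) : {set T} :=
  [set y in S | (y != x) && c [set x; y]].

(** A partial embedding is a total function whose values outside [A] are ignored, so it can be
    extended one vertex at a time. *)
Definition blue_embedding (G : sgraph) (A : {set G}) (S : {set T})
    (f : G -> T) : Prop :=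
  [/\ {in A &, injective f}, {in A, forall x, f x \in S}
    & {in A &, forall x y, adj x y -> c [set f x; f y] = false}].

Definition red_clique_free (r : nat) (S : {set T}) : Prop :=
  forall B : {set T}, B \subset S -> mono_clique c true B -> #|B| != r.

(** Adding [x] to a red clique in its red neighbourhood gives a larger red clique. *)
Lemma red_nbhd_clique_free r (S : {set T}) x :
  x \in S -> red_clique_free r.+1 S -> red_clique_free r (red_nbhd S x).
Proof.
move=> xS free B sB Bred.
have xB : x \notin B by apply/negP => /(subsetP sB); rewrite !inE eqxx andbF.
have : #|x |: B| != r.+1.
  apply: free.
    rewrite subUset sub1set xS; apply: subset_trans sB _.
    by apply/subsetP => y; rewrite inE => /andP[].
  by apply: mono_clique_add => // y /(subsetP sB); rewrite !inE => /and3P[].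
by rewrite cardsU1 xB.
Qed.

Lemma exists_injection (U : finType) (A : {set U}) (S : {set T}) (t0 : T) :
  #|A| <= #|S| ->
  exists f : U -> T, {in A &, injective f} /\ {in A, forall x, f x \in S}.
Proof.
move=> AS; exists (fun x => nth t0 (enum S) (index x (enum A))).
have idx x : x \in A -> index x (enum A) < size (enum S).
  by move=> xA; rewrite -cardE (leq_trans _ AS) // cardE index_mem mem_enum.
split=> [x y xA yA /eqP|x xA]; last by rewrite -mem_enum mem_nth ?idx.
rewrite nth_uniq ?idx ?enum_uniq // => /eqP eq_idx.
by apply: (index_inj x (s := enum A)) eq_idx; rewrite mem_enum.
Qed.

(** The vertices of [B :\: A] are placed one by one. The image of [v] must avoid the images already
    used and the red neighbourhoods, of size at most [D], of the images of neighbours of [v]; the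
    last hypothesis leaves a free vertex. *)
Lemma greedy_extension (G : sgraph) (S : {set T}) (D : nat) (A B : {set G}) f :
    A \subset B -> blue_embedding A S f ->
    {in S, forall x, #|red_nbhd S x| <= D} ->
    {in B :\: A, forall v, #|[set u in B | adj v u]| * D + #|B| <= #|S|} ->
  exists g, blue_embedding B S g.
Proof.
move En: #|B :\: A| => n; elim: n A f En => [|n IHn] A f En sAB emb degS room.
  exists f; suff -> : B = A by [].
  by apply/eqP; rewrite eqEsubset sAB andbT -setD_eq0 -cards_eq0 En.
have /card_gt0P[v vBA] : 0 < #|B :\: A| by rewrite En.
have [vB vA] : v \in B /\ v \notin A by move: vBA; rewrite inE => /andP[].
case: emb => finj fS fblue.
pose nbv := [set u in A | adj v u].
(* [F] collects the host vertices forbidden for [v]. *)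
pose F := (f @: A) :|: \bigcup_(u in nbv) red_nbhd S (f u).
have ltF : #|F| < #|S|.
  apply: leq_trans (room v vBA).
  have cU : #|\bigcup_(u in nbv) red_nbhd S (f u)| <= #|nbv| * D.
    rewrite -sum_nat_const.
    apply: (@leq_trans (\sum_(u in nbv) #|red_nbhd S (f u)|)); last first.
      by apply: leq_sum => u; rewrite inE => /andP[uA _]; apply/degS/fS/uA.
    elim/big_rec2: _ => [|u a b _ ab]; first by rewrite cards0.
    by rewrite (leq_trans (leq_card_setU _ _)) // leq_add2l.
  have cnb : #|nbv| <= #|[set u in B | adj v u]|.
    apply/subset_leq_card/subsetP => u.
    by rewrite !inE => /andP[/(subsetP sAB)-> ->].
  have ltA : #|A| < #|B|.
    by apply/proper_card/properP; split=> //; exists v.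
  rewrite addnC; apply: leq_ltn_trans (leq_card_setU _ _) _.
  apply: leq_trans (_ : (#|A| + #|nbv| * D).+1 <= _).
    by rewrite ltnS leq_add // leq_imset_card.
  by rewrite -addSn leq_add // leq_mul2r cnb orbT.
have [w wS wF] : exists2 w, w \in S & w \notin F.
  by apply/subsetPn; apply: contraTN ltF => /subset_leq_card; rewrite -leqNgt.
have wA u : u \in A -> f u != w.
  move=> uA; apply: contraNneq wF => <-.
  by rewrite inE imset_f.
have wblue u : u \in A -> adj v u -> c [set f u; w] = false.
  move=> uA vu; apply: contraNF wF => red.
  rewrite inE; apply/orP; right; apply/bigcupP; exists u; first by rewrite inE uA.
  by rewrite inE wS red andbT eq_sym wA.
have neqv u : u \in A -> (u == v) = false.
  by move=> uA; apply: contraNF vA => /eqP<-.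
apply: (IHn (v |: A) (fun x => if x == v then w else f x)).
- by apply: succn_inj; rewrite -En (cardsD1 v (B :\: A)) vBA setDDl setUC.
- by rewrite subUset sub1set vB.
- split=> [x y|x|x y].
  + rewrite !inE => /predU1P[->|xA] /predU1P[->|yA] //=; rewrite ?eqxx ?neqv //.
    * by move=> Ew; have := wA _ yA; rewrite Ew eqxx.
    * by move=> Ew; have := wA _ xA; rewrite Ew eqxx.
    * exact: finj.
  + by rewrite !inE => /predU1P[->|xA]; rewrite ?eqxx ?neqv ?fS.
  + rewrite !inE => /predU1P[->|xA] /predU1P[->|yA] //=; rewrite ?eqxx ?neqv //.
    * by rewrite adj_irrefl.
    * by move=> vy; rewrite setUC wblue.
    * by rewrite adj_sym; apply: wblue.
    * exact: fblue.
- exact: degS.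
- move=> u; rewrite !inE negb_or -andbA => /and3P[_ uA uB].
  by apply: room; rewrite inE uA.
Qed.

End Embedding.

(** * Blue copies of [G] in the absence of red cliques *)

Section Bound.
Local Open Scope nat_scope.
Variables (T : finType) (c : {set T} -> bool) (G : sgraph).
Hypotheses (G_gt0 : 0 < #|G|) (noiso : no_isolated G).
Let m := #|edges G|.

Lemma no_isolated_edges_gt0 : 0 < m.
Proof. by have := no_isolated_card noiso; rewrite /m; lia. Qed.

Lemma triangle_free_embedding (S : {set T}) :
  4 * m <= #|S| -> red_clique_free c 3 S ->
  exists f, blue_embedding c [set: G] S f.
Proof.
move=> leS free; have n2m := no_isolated_card noiso; rewrite -/m in n2m.
have /card_gt0P[x0 x0S] : 0 < #|S| by have := no_isolated_edges_gt0; lia.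
pose D := \max_(x in S) #|red_nbhd c S x|.
have degS : {in S, forall x, #|red_nbhd c S x| <= D}.
  by move=> x xS; apply: (@leq_bigmax_cond _ (mem S) (fun x => #|red_nbhd c S x|)).
have [w wS Dw] : {w | w \in S & D = #|red_nbhd c S w|}.
  by apply: eq_bigmax_cond; apply/card_gt0P; exists x0.
have leA : #|large_degree G D| <= #|red_nbhd c S w|.
  by rewrite -Dw card_large_degree.
have [f [finj fN]] := exists_injection x0 leA.
apply: (greedy_extension (A := large_degree G D) (f := f) _ _ degS).
- exact: subsetT.
- split=> // [x /fN|x y xA yA xy]; first by rewrite inE => /andP[].
  have neq : f x != f y.
    by apply: contraTneq xy => /finj->; rewrite ?adj_irrefl.
  (* A red edge inside the red neighbourhood of [w] would close a red triangle with [w]. *)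
  apply: contraTF isT => red.
  have /(_ [set f x; f y]) := red_nbhd_clique_free wS free.
  rewrite cards2 neq eqxx; apply; first by rewrite subUset !sub1set !fN.
  move=> a b; rewrite !inE => /orP[]/eqP-> /orP[]/eqP->; rewrite ?eqxx //.
  by rewrite setUC.
move=> v; rewrite !inE andbT -leqNgt -/m => leD.
rewrite cardsT; apply: leq_trans leS.
have -> : #|[set u in [set: G] | adj v u]| = degree v.
  by apply: eq_card => u; rewrite !inE.
lia.
Qed.

(** Here [t] plays the role of sqrt (2m). The bounds b_k = (4 + 2k) m t^k satisfy b_0 = 4m and t b_k
    + 2m <= b_(k+1), which is the room for at most [t] embedded neighbours, each excluding b_k
    vertices, and for at most 2m vertices of [G]. *)
Lemma clique_free_embedding (t k : nat) (S : {set T}) :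
    2 * m <= t * t -> (4 + 2 * k) * m * t ^ k <= #|S| ->
    red_clique_free c k.+3 S ->
  exists f, blue_embedding c [set: G] S f.
Proof.
move=> tm; have n2m := no_isolated_card noiso; rewrite -/m in n2m.
have m_gt0 := no_isolated_edges_gt0.
elim: k S => [|k IHk] S leS free.
  by apply: triangle_free_embedding free; rewrite muln1 in leS.
set b := (4 + 2 * k) * m * t ^ k in IHk.
have t_gt0 : 0 < t by nia.
have leb : t * b + 2 * m <= #|S|.
  apply: leq_trans leS; rewrite /b expnS.
  have : 0 < t * t ^ k by rewrite muln_gt0 t_gt0 expn_gt0 t_gt0.
  nia.
have [/existsP[x /andP[xS ltb]]|] := boolP [exists x in S, b <= #|red_nbhd c S x|].
  have [f [finj fN fblue]] := IHk _ ltb (red_nbhd_clique_free xS free).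
  by exists f; split=> // y /fN; rewrite inE => /andP[].
move=> /exists_inPn noDeg.
have degS : {in S, forall x, #|red_nbhd c S x| <= b}.
  by move=> x /noDeg; rewrite -ltnNge => /ltnW.
have /card_gt0P[x0 _] : 0 < #|S| by lia.
have emb0 : blue_embedding c (set0 : {set G}) S (fun=> x0).
  by split=> x; rewrite ?inE // => y; rewrite inE.
have leL := card_large_degree G t.
have [f embL] : exists f, blue_embedding c (large_degree G t) S f.
  (* Within [large_degree G t] a vertex has at most [t] neighbours, since the set has at most [t]
     elements. *)
  apply: (greedy_extension (sub0set _) emb0 degS) => v _.
  apply: leq_trans leb; apply: leq_add.
    rewrite leq_mul2r (leq_trans _ leL) ?orbT //.
    by apply/subset_leq_card/subsetP => u; rewrite inE => /andP[].
  exact: leq_trans (max_card _) n2m.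
(* For the remaining vertices, degree v * t <= 2m <= t * t, hence the degree is at most [t]. *)
apply: (greedy_extension (subsetT _) embL degS) => v.
rewrite !inE andbT -leqNgt -/m => led.
apply: leq_trans leb; rewrite cardsT leq_add //.
have -> : #|[set u in [set: G] | adj v u]| = degree v.
  by apply: eq_card => u; rewrite !inE.
by rewrite leq_mul2r -(leq_pmul2r t_gt0) (leq_trans led tm) orbT.
Qed.

End Bound.

(** * From embeddings to the Ramsey number *)

Lemma ramsey_number_le (N : nat) (H G : sgraph) :
  (0 < N)%N -> arrows N H G -> (ramsey_number H G <= N)%N.
Proof.
move=> N_gt0 NHG; rewrite /ramsey_number; case: ex_minnP => n _; apply.
by rewrite N_gt0.
Qed.

Lemma ramsey_clique_le (k t : nat) (G : sgraph) :
    (0 < #|G|)%N -> no_isolated G -> (2 * #|edges G| <= t * t)%N ->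
  (ramsey_number (complete_graph k.+3) G <= (4 + 2 * k) * #|edges G| * t ^ k)%N.
Proof.
move=> G_gt0 noiso tm; have m_gt0 := no_isolated_edges_gt0 G_gt0 noiso.
apply: ramsey_number_le.
  by rewrite !muln_gt0 addn_gt0 m_gt0 expn_gt0 /=; apply/orP; left; nia.
set N := (_ * _)%N; apply/forallP => c; apply/orP.
have [|noRed] := boolP (mono_copy c true _); [by left | right].
have free : red_clique_free c k.+3 [set: 'I_N].
  move=> B _ Bred; apply: contraNneq noRed => cB.
  by apply: mono_clique_copy Bred; rewrite cB card_ord.
have leN : (N <= #|[set: 'I_N]|)%N by rewrite cardsT card_ord.
have [f [finj _ fblue]] := clique_free_embedding G_gt0 noiso tm leN free.
apply/existsP; exists (finfun f); apply/andP; split.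
  by apply/injectiveP => x y; rewrite !ffunE; apply: finj; rewrite inE.
apply/'forall_forallP => x y; apply/implyP => xy; rewrite !ffunE.
by rewrite fblue ?inE.
Qed.

(** The least [t] with 2m <= t^2 works, because (t - 1)^2 < 2m. The factor 9 is a square, so that t
    <= 3 sqrt m. *)
Lemma exists_sqrt_ge (m : nat) :
  (0 < m)%N -> exists t, (2 * m <= t * t <= 9 * m)%N.
Proof.
move=> m_gt0; have ex : exists t, (2 * m <= t * t)%N by exists (2 * m)%N; nia.
exists (ex_minn ex); case: ex_minnP => t tm /(_ t.-1) min; rewrite tm /=.
have : (t.-1 * t.-1 < 2 * m)%N by rewrite ltnNge; apply/negP => /min; nia.
nia.
Qed.

Theorem theorem3 (R : realType) (r : nat) (hr : (3 <= r)%N) :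
  exists c : R, forall (G : sgraph) (m : nat),
    (0 < #|G|)%N -> no_isolated G -> #|edges G| = m ->
    (ramsey_number (complete_graph r) G)%:R <= c * m%:R `^ ((r%:R - 1) / 2%:R).
Proof.
(* With r = k + 3 and t <= 3 sqrt m, the bound (4 + 2k) m t^k is at most (4 + 2k) 3^k m^(1 + k/2),
   and 1 + k/2 = (r - 1)/2. *)
case: r hr => [|[|[|k]]] // _; exists ((4 + 2 * k)%:R * 3%:R ^+ k).
move=> G m G_gt0 noiso Em.
have m_gt0 : (0 < m)%N by rewrite -Em (no_isolated_edges_gt0 G_gt0 noiso).
have [t /andP[tm mt]] := exists_sqrt_ge m_gt0.
pose s : R := m%:R `^ 2^-1.
have s_ge0 : 0 <= s by exact: powR_ge0.
have ss : s ^+ 2 = m%:R.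
  by rewrite -powR_mulrn // -powRrM mulVf ?pnatr_eq0 // powRr1.
have ts : t%:R <= 3%:R * s.
  rewrite -(@ler_pXn2r _ 2) ?nnegrE ?mulr_ge0 // exprMn ss -!natrX -natrM ler_nat.
  by rewrite -mulnn.
have -> : m%:R `^ ((k.+3%:R - 1) / 2%:R) = m%:R * s ^+ k.
  rewrite -[X in _ = X * _]ss -exprD -powR_mulrn // -powRrM mulrC.
  by rewrite -[k.+3%:R]natr1 addrK.
rewrite -Em in tm.
have := ramsey_clique_le k G_gt0 noiso tm.
rewrite Em -(ler_nat R) => /le_trans; apply.
rewrite !natrM natrX mulrACA -exprMn -!mulrA.
by rewrite ler_wpM2l // ler_wpM2l // lerXn2r ?nnegrE ?mulr_ge0.
Qed.
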